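(* With the maps $CSV:D_0\to R_{\le-1}$ and $GK:W_{121}\to B_{21}$ defined in the context, $\phi$ Foata's fundamental bijection, and each partition $\lambda$ identified with its word $w(\lambda)$, we have $$CSV=\phi\circ GK\circ\phi^{-1}.$$
   Context: $\mathbb P^*$ is the set of all finite words in the positive integers, $\epsilon$ the empty word. Foata's fundamental bijection $\phi:\mathbb P^*\to\mathbb P^*$: $\phi(\epsilon)=\epsilon$. For $v=a_1\ldots a_n$ with $n\ge1$, define $w_1=a_1$ and, given $w_i=b_1\ldots b_i$, define $w_{i+1}$ as follows. If $b_i\le a_{i+1}$ (respectively $b_i>a_{i+1}$), factor $w_i=f_1f_2\cdots f_k$ uniquely so that in each factor every letter is $>a_{i+1}$ (respectively $\le a_{i+1}$) except its last letter, which is $\le a_{i+1}$ (respectively $>a_{i+1}$). Let $g_j$ be obtained from $f_j$ by moving its last letter to the front, and set $w_{i+1}=g_1g_2\cdots g_k\,a_{i+1}$. Then $\phi(v)=w_n$. The map $\phi$ is a bijection preserving the multiset of letters. Partitions and words: for a partition $\lambda$ with conjugate $\lambda'$, $d(\lambda)$ is the side length of the Durfee square (largest $d\times d$ square in the Ferrers diagram), $r_i(\lambda)=\lambda_i-\lambda_i'$ for $1\le i\le d(\lambda)$, $r(\lambda)=\max_{1\le i\le d(\lambda)}r_i(\lambda)$, with the convention $r(\emptyset)=-1$. $R_{\le-1}$ is the set of partitions with $r_i(\lambda)\le-1$ for all $1\le i\le d(\lambda)$. $D_0$ is the set of partitions with $\lambda_1=\lambda_2$ (missing parts counted as $0$,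 so $\emptyset\in D_0$). Each $\lambda=(\lambda_1\ge\cdots\ge\lambda_k>0)$ is identified with the word $w(\lambda)=2^{\lambda_k}\,1\,2^{\lambda_{k-1}-\lambda_k}\,1\cdots2^{\lambda_1-\lambda_2}\,1$, and $\emptyset$ with $\epsilon$. A word in $\{1,2\}^*$ is a ballot sequence if every prefix contains at least as many ones as twos. $W_{121}=\{x121: x\in\{1,2\}^*\}\cup\{\epsilon\}$ and $B_{21}$ is the set of ballot sequences in $\{x21: x\in\{1,2\}^*\}\cup\{\epsilon\}$. Under the identification, $\phi^{-1}(D_0)=W_{121}$ and $\phi^{-1}(R_{\le-1})=B_{21}$. $CSV$ (Corteel–Savage–Venkatraman, conjugated): on input $\lambda\in D_0$, while $r(\lambda)\ge0$ do the following: let $i$ be the maximum index with $r_i(\lambda)=r(\lambda)$; remove a part of size $i$ from $\lambda'$ (i.e. delete a column of length $i$ from the Ferrers diagram of $\lambda$), then add a part of size $i-1$ to $\lambda$, and increase the largest part $\lambda_1$ by one. Output the final $\lambda$. It is known (Corteel–Savage–Venkatraman) that for input in $D_0$ the required part always exists while $r(\lambda)\ge 0$ and that the procedure terminates, with output in $R_{\le-1}$. $GK$: in a word in $\{1,2\}^*$, pair ones and twos like left and right parentheses, respectively (a one immediately followed by a two is paired; remove all such pairs and iterate on the remaining word). For a word $w$ with at least one unpaired two, $\gamma(w)$ is $w$ with its rightmost unpaired two changed to a one; $\gamma^t$ is the $t$-fold iterate. For $v=x121\in W_{121}$ with exactly $t$ unpaired twos (all necessarily in $x$), $GK(v)=\gamma^t(x)\,1\,2^{t+1}\,1$;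 and $GK(\epsilon)=\epsilon$. *)

(* Defs.v *)
From HB Require Import structures.
From mathcomp Require Import all_boot all_order all_algebra.

Set Implicit Arguments.
Unset Strict Implicit.
Unset Printing Implicit Defensive.

Import Order.TTheory GRing.Theory Num.Theory.

(* Letters are arbitrary natural numbers; the words attached to partitions
   only use 1 and 2. *)
Notation word := (seq nat).

(* Cut w after each letter satisfying p; acc is the factor being read. *)
Fixpoint factors_rec (p : pred nat) (acc w : word) : seq word :=
  match w with
  | [::] => if acc is [::] then [::] else [:: acc]
  | b :: w' => if p b then rcons acc b :: factors_rec p [::] w'
               else factors_rec p (rcons acc b) w'
  end.

Definition factors p w := factors_rec p [::] w.

(* rotr 1 moves the last letter of a word to the front. *)
Definition rot_factors p w : word := flatten [seq rotr 1 f | f <- factors p w].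

(* The letters that end a factor when a is inserted, b being the letter that
   is compared with a. *)
Definition foata_pred (b a : nat) : pred nat :=
  if b <= a then (fun c => c <= a) else (fun c => a < c).

Definition foata_step (w : word) (a : nat) : word :=
  rcons (rot_factors (foata_pred (last 0 w) a) w) a.

Definition phi (v : word) : word :=
  if v is a :: v' then foldl foata_step [:: a] v' else [::].

(* Inverse of phi: if u = rcons u' a then each g_j in u' = g_1 ... g_k starts
   with the letter that ended f_j, so reading u' backwards turns the g_j into
   factors for the same predicate, recognised on the first letter of u'. *)
Fixpoint phi_inv_rec (n : nat) (u : word) : word :=
  if n is n'.+1 then
    if u is b :: u1 then
      let u' := belast b u1 in
      let a := last b u1 in
      rcons (phi_inv_rec n'
               (rev (rot_factors (foata_pred (head 0 u') a) (rev u')))) a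
    else [::]
  else [::].

Definition phi_inv (u : word) : word := phi_inv_rec (size u) u.

Section PhiBijective.

Variable p : pred nat.

Let endp (w : word) := (w == [::]) || p (last 0 w).
Let startp (w : word) := (w == [::]) || p (head 0 w).

Lemma factors_rec_block acc h b w :
  all (predC p) h -> p b ->
  factors_rec p acc (h ++ b :: w) = (acc ++ rcons h b) :: factors p w.
Proof.
move=> + pb; elim: h acc => [|c h IH] acc /=; first by rewrite pb cats1.
by move=> /andP[/negbTE-> hh]; rewrite IH // cat_rcons.
Qed.

Lemma rot_block h b w : all (predC p) h -> p b ->
  rot_factors p (h ++ b :: w) = b :: h ++ rot_factors p w.
Proof.
move=> hh pb; rewrite /rot_factors /factors factors_rec_block //=.
rewrite /rotr size_rcons subn1 /= -cats1 rot_size_cat /=.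
by [].
Qed.

Lemma block_ind (P : word -> Prop) : P [::] ->
  (forall h b w, all (predC p) h -> p b -> endp w -> P w -> P (h ++ b :: w)) ->
  forall w, endp w -> P w.
Proof.
move=> P0 PS w; have [n] := ubnP (size w); elim: n w => // n IH w szw ew.
case: (boolP (has p w)) => [hw|nw]; last first.
  case/lastP: w ew nw {szw} => // w x.
  by rewrite /endp last_rcons has_rcons; case: (p x); case: w.
case/split_find: hw ew szw => b h w2 pb nh ew szw.
have ew2 : endp w2.
  by move: ew; rewrite /endp last_cat; case: (w2) => //= c w3; case: (h).
rewrite cat_rcons; apply: PS => //; first by rewrite all_predC.
apply: IH ew2; move: szw; rewrite size_cat size_rcons ltnS; apply: leq_trans.
by rewrite addSn ltnS leq_addl.
Qed.

Lemma rot_cat u w : endp u ->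
  rot_factors p (u ++ w) = rot_factors p u ++ rot_factors p w.
Proof.
move=> eu; elim/block_ind: u / eu => // h b u hh pb _ IH.
by rewrite -catA /= !rot_block // IH /= catA.
Qed.

Lemma endp_rev w : endp (rev w) = startp w.
Proof.
case: w => [|b w]; rewrite /endp /startp // rev_cons last_rcons.
by case: (rev w).
Qed.

Lemma startp_rot w : endp w -> startp (rot_factors p w).
Proof.
move=> ew; elim/block_ind: w / ew => // h b w hh pb _ _.
by rewrite rot_block // /startp /= pb.
Qed.

Lemma rotK w : endp w -> rev (rot_factors p (rev (rot_factors p w))) = w.
Proof.
move=> ew; elim/block_ind: w / ew => // h b w hh pb ew IH.
rewrite rot_block // rev_cons rev_cat rcons_cat rot_cat; last first.
  by rewrite endp_rev startp_rot.
rewrite rev_cat IH -cats1 rot_block ?all_rev //=.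
by rewrite cats0 rev_cons revK cat_rcons.
Qed.

Lemma rot_size w : endp w -> size (rot_factors p w) = size w.
Proof.
move=> ew; elim/block_ind: w / ew => // h b w hh pb _ IH.
by rewrite rot_block //= !size_cat IH /= addnS.
Qed.

End PhiBijective.

Lemma foata_pred_self b a : foata_pred b a b.
Proof. by rewrite /foata_pred; case: leqP. Qed.

Lemma foata_predP b c a : foata_pred b a c -> foata_pred c a = foata_pred b a.
Proof.
by rewrite /foata_pred; case: (leqP b a) => _; [move->|rewrite ltnNge => /negbTE->].
Qed.

Lemma phi_rcons v a : phi (rcons v a) = foata_step (phi v) a.
Proof. by case: v => [|b v] //=; rewrite foldl_rcons. Qed.

Lemma phi_inv_rec_rcons n u a : phi_inv_rec n.+1 (rcons u a) =
  rcons (phi_inv_rec n (rev (rot_factors (foata_pred (head 0 u) a) (rev u)))) a.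
Proof.
by rewrite headI; case: u => [|b u] //=; rewrite belast_rcons last_rcons.
Qed.

Lemma size_phi v : size (phi v) = size v.
Proof.
elim/last_ind: v => // v a IH; rewrite phi_rcons !size_rcons rot_size ?IH //.
by rewrite foata_pred_self orbT.
Qed.

Lemma phiK : cancel phi phi_inv.
Proof.
move=> v; rewrite /phi_inv size_phi; elim/last_ind: v => // v a IH.
rewrite phi_rcons size_rcons phi_inv_rec_rcons; congr rcons.
set w := phi v in IH *; set p := foata_pred (last 0 w) a.
have ew : (w == [::]) || p (last 0 w) by rewrite /p foata_pred_self orbT.
case: (eqVneq w [::]) => [w0|wN0].
  by rewrite -[RHS]IH w0.
have : foata_pred (head 0 (rot_factors p w)) a = p.
  apply: foata_predP; rewrite -/p; case/orP: (startp_rot ew) => // /eqP r0.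
  by case/negP: wN0; rewrite -size_eq0 -(rot_size ew) r0.
by move->; rewrite rotK.
Qed.

Lemma phi_invK : cancel phi_inv phi.
Proof.
move=> u; rewrite /phi_inv; move: {-1}(size u) (erefl (size u)) => n.
elim: n u => [|n IH] u; first by case: u.
case/lastP: u => // u a; rewrite size_rcons => -[szu].
rewrite phi_inv_rec_rcons phi_rcons; set p := foata_pred (head 0 u) a.
have su : (rev u == [::]) || p (last 0 (rev u)).
  by rewrite (endp_rev p u) /p foata_pred_self orbT.
rewrite IH; last by rewrite size_rev rot_size // size_rev.
rewrite /foata_step; congr rcons.
have -> : foata_pred (last 0 (rev (rot_factors p (rev u)))) a = p.
  case: (eqVneq u [::]) => [u0|uN0]; first by rewrite /p u0.
  apply: foata_predP; rewrite -/p.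
  have := startp_rot su; rewrite -(@endp_rev p) => /orP[/eqP r0|//].
  case/negP: uN0; rewrite -size_eq0 -(size_rev u) -(rot_size su).
  by rewrite -(size_rev (rot_factors _ _)) r0.
by apply: (can_inj revK); rewrite rotK.
Qed.

Definition is_part (s : seq nat) := sorted geq s && (0 \notin s).

Record intpart := IntPart { parts :> seq nat; _ : is_part parts }.

HB.instance Definition _ := [isSub for parts].
HB.instance Definition _ := [Choice of intpart by <:].

(* lambda_i, with i counted from 1 and missing parts equal to 0. *)
Definition part (s : seq nat) (i : nat) : nat := nth 0 s i.-1.

Definition conj_seq (s : seq nat) : seq nat :=
  [seq count (leq j) s | j <- iota 1 (head 0 s)].

Lemma conj_seq_part s : is_part (conj_seq s).
Proof.
rewrite /is_part /conj_seq; apply/andP; split.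
  rewrite sorted_map; apply: (sub_sorted (e := ltn)) (iota_ltn_sorted _ _).
  move=> i j /ltnW ij /=; apply: sub_count => x /=; exact: leq_trans.
apply/mapP => -[j]; rewrite mem_iota add1n ltnS => /andP[j1 jh].
case: s jh => [|x s] /=; first by rewrite leqNgt j1.
by move=> ->.
Qed.

Definition conj (lam : intpart) : intpart := IntPart (conj_seq_part lam).

Lemma rem_part_subproof (i : nat) (lam : intpart) : is_part (rem i lam).
Proof.
case: lam => s /= /andP[ss s0]; apply/andP; split.
  apply: (subseq_sorted _ (rem_subseq i s) ss).
  by move=> a b c /= h1 h2; apply: leq_trans h1.
by apply: contra s0; apply: mem_rem.
Qed.

Definition rem_part i lam : intpart := IntPart (rem_part_subproof i lam).

Definition add_part_seq (k : nat) (s : seq nat) : seq nat :=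
  if k is 0 then s else sort geq (k :: s).

Lemma add_part_subproof (k : nat) (lam : intpart) : is_part (add_part_seq k lam).
Proof.
case: lam k => s sP [|k] //=; case/andP: sP => ss s0; apply/andP; split.
  by apply: sort_sorted => a b /=; apply: leq_total.
by rewrite mem_sort inE.
Qed.

Definition add_part k lam : intpart := IntPart (add_part_subproof k lam).

Lemma incr_first_subproof (lam : intpart) : is_part (incr_nth lam 0).
Proof.
case: lam => -[|x s] //=; case/andP=> /= ss; rewrite inE negb_or => /andP[_ s0].
rewrite /is_part inE s0 andbT /=.
by case: s ss {s0} => //= y s /andP[yx ->]; rewrite leqW.
Qed.

Definition incr_first lam : intpart := IntPart (incr_first_subproof lam).

Definition durfee (lam : intpart) : nat :=
  \max_(k < (size lam).+1 | all (leq k) (take k lam)) k.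

Definition rdiff (lam : intpart) (i : nat) : int :=
  ((part lam i)%:Z - (part (conj lam) i)%:Z)%R.

Definition rmax (lam : intpart) : int :=
  if durfee lam == 0 then (-1)%R
  else \big[Num.max/rdiff lam 1]_(1 <= i < (durfee lam).+1) rdiff lam i.

Definition R_le_m1 : {pred intpart} :=
  [pred lam | all (fun i => rdiff lam i <= -1)%R (iota 1 (durfee lam))].

Definition D_0 : {pred intpart} := [pred lam : intpart | part lam 1 == part lam 2].

Definition word_of_part (lam : intpart) : word :=
  flatten [seq rcons (nseq (part lam i - part lam i.+1) 2) 1
          | i <- rev (iota 1 (size lam))].

Definition csv_index (lam : intpart) : nat :=
  \max_(1 <= i < (durfee lam).+1 | rdiff lam i == rmax lam) i.

Definition csv_step (lam : intpart) : intpart :=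
  let i := csv_index lam in
  incr_first (add_part i.-1 (conj (rem_part i (conj lam)))).

(* Evaluation of the while loop: CSV lam mu holds when the procedure, started
   on lam, runs without getting stuck, terminates, and outputs mu. *)
Inductive CSV : intpart -> intpart -> Prop :=
| CSV_stop lam : (rmax lam < 0)%R -> CSV lam lam
| CSV_loop lam mu : (0 <= rmax lam)%R -> csv_index lam \in (conj lam : seq nat) ->
    CSV (csv_step lam) mu -> CSV lam mu.

Lemma CSV_fun lam mu nu : CSV lam mu -> CSV lam nu -> mu = nu.
Proof.
move=> H; elim: H nu => {lam mu} [lam r0|lam mu r0 _ _ IH] nu H.
  by case: H r0 => // l m r0 _ _; rewrite ltNge r0.
by case: H r0 IH => [l l0|l m _ _ H] r0 IH; [rewrite ltNge r0 in l0|apply: IH].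
Qed.

Lemma CSV_range lam mu : CSV lam mu -> mu \in R_le_m1.
Proof.
elim=> // {mu}lam' r0; apply/allP => i; rewrite mem_iota add1n => /andP[i1 id].
have d0 : durfee lam' != 0 by rewrite -lt0n; apply: leq_trans i1 _.
move: r0; rewrite /rmax (negPf d0) => r0.
suff: (rdiff lam' i < 0)%R by case: (rdiff lam' i).
apply: le_lt_trans r0; apply: le_bigmax_seq => //.
by rewrite mem_index_iota i1.
Qed.

(* Letters paired with their positions; one pass removes all the factors 12. *)
Fixpoint remove12 (s : seq (nat * nat)) : seq (nat * nat) :=
  match s with
  | x :: ((y :: s2) as s1) =>
      if (x.1 == 1) && (y.1 == 2) then remove12 s2 else x :: remove12 s1
  | _ => s
  end.

(* size w passes are enough to remove all the pairs. *)
Definition unpaired (w : word) : seq (nat * nat) :=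
  iter (size w) remove12 (zip w (iota 0 (size w))).

(* Positions of the unpaired twos, in increasing order. *)
Definition unpaired2 (w : word) : seq nat :=
  [seq x.2 | x <- unpaired w & x.1 == 2].

Definition gamma (w : word) : word :=
  if unpaired2 w is i :: s then set_nth 0 w (last i s) 1 else w.

(* Only meaningful on the empty word and on words of the form x121. *)
Definition GK (v : word) : word :=
  if v is [::] then [::] else
  let x := take (size v - 3) v in
  let t := size (unpaired2 v) in
  iter t gamma x ++ [:: 1] ++ nseq t.+1 2 ++ [:: 1].

(* Main.v *)
Require Import Defs.
From mathcomp Require Import all_boot all_order all_algebra.
From mathcomp Require Import zify.

(** Foata's bijection has a closed form on words in 1 and 2: phi v consists of
    the letters of v that are followed by a 1, in reverse order, then the
    letters that are followed by a 2, in order, then the last letter of v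
    ([phi_binary]).

    Let v end with 1 and let the word of the partition lam be phi v.  The
    descents 21 of v contribute the twos of the reversed half of phi v, that
    is, the first columns of lam; the ascents 12 and the final 1 contribute the
    ones of the other half, that is, the first rows.  Hence the Durfee square of
    lam has as many rows as v has descents ([durfee_desc]), and if v = p21q and
    i is the number of descents from this one onwards, then r_i(lam) is the
    number of twos minus the number of ones in p ([rdiff_peak]).  So the r_i are
    the heights of v just before its peaks, read from right to left.  If some
    two of v is unpaired, then their maximum is one less than the number of
    unpaired twos, and the largest index that attains it belongs to the leftmost
    highest peak, whose two is the rightmost unpaired two
    ([csv_index_last_unpaired]).  If all the twos of v are paired, then
    r(lam) < 0 ([rmax_ballot]).

    Suppose now that v = p 2 q 1, where the displayed 2 is the rightmost
    unpaired two and q starts with 1 and ends with 2.  Comparing the closed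
    forms of phi (p 2 q 1) and phi (p 1 q 2 1) shows that the second word arises
    from the first by erasing a 2 (a column of length i), inserting a 1 that has
    i - 1 twos on its left (a row of length i - 1), and inserting a 2 before the
    last letter (the first row grows by one): see [phi_flip].  This is exactly
    one round of the CSV loop ([csv_step_flip]).  On the other side,
    p 2 q 1 -> p 1 q 2 1 is one application of gamma followed by the insertion
    of one of the final twos of GK.  Iterating until no two is unpaired gives
    the theorem, including the termination of CSV ([CSV_iter_gamma]).

    Words are turned back into partitions through the lists [rows] and [cols];
    the pairing of ones and twos is followed from left to right by [scan]. *)

Set Implicit Arguments.
Unset Strict Implicit.
Unset Printing Implicit Defensive.

Import Order.TTheory GRing.Theory Num.Theory.

(** * Rows and columns of a lattice path *)

Definition binary (w : word) := all (fun a => (a == 1) || (a == 2)) w.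

(** A word is the boundary of a Ferrers diagram: each 1 ends a row, whose length
    is the number of twos on its left, and each 2 ends a column, whose length is
    the number of ones on its right.  Both lists are nonincreasing; they have
    zero entries when the word starts with 1, respectively ends with 2. *)
Fixpoint rows (w : word) : seq nat :=
  if w is a :: w' then
    if a == 2 then map succn (rows w')
    else if a == 1 then rcons (rows w') 0 else rows w'
  else [::].

Fixpoint cols (w : word) : seq nat :=
  if w is a :: w' then
    if a == 2 then count_mem 1 w' :: cols w' else cols w'
  else [::].

Lemma rows_cat u w :
  rows (u ++ w) = map (addn (count_mem 2 u)) (rows w) ++ rows u.
Proof.
elim: u => [|a u IH] /=; first by rewrite cats0 (eq_map add0n) map_id.
case: (eqVneq a 2) => [a2|a2] /=; rewrite ?a2 /=.
  by rewrite IH map_cat -map_comp.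
by rewrite add0n IH; case: (a == 1); rewrite ?rcons_cat.
Qed.

Lemma cols_cat u w :
  cols (u ++ w) = map (addn (count_mem 1 w)) (cols u) ++ cols w.
Proof.
elim: u => [|a u IH] //=; case: ifP => _ //=.
by rewrite IH count_cat addnC.
Qed.

Lemma size_rows u : size (rows u) = count_mem 1 u.
Proof.
elim: u => [|a u IH] //=; case: (eqVneq a 2) => [a2|a2] /=; rewrite ?a2 /=.
  by rewrite size_map.
by case: (a == 1); rewrite ?size_rcons IH.
Qed.

Lemma size_cols u : size (cols u) = count_mem 2 u.
Proof. by elim: u => [|a u IH] //=; case: ifP => _ /=; rewrite IH. Qed.

Lemma rows_le u : all (geq (count_mem 2 u)) (rows u).
Proof.
elim: u => [|a u IH] //=; case: (eqVneq a 2) => [a2|a2] /=; rewrite ?a2 /=.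
  by rewrite all_map; apply: sub_all IH.
by case: (a == 1); rewrite ?all_rcons.
Qed.

Lemma cols_le u : all (geq (count_mem 1 u)) (cols u).
Proof.
elim: u => [|a u IH] //=; case: (eqVneq a 2) => [a2|a2] /=; rewrite ?a2 /=.
  by rewrite leqnn.
by apply: sub_all IH => x /= h; apply: leq_trans h _; rewrite leq_addl.
Qed.

Lemma geq_trans : transitive geq.
Proof. by move=> a b c /= h1 h2; apply: leq_trans h1. Qed.

Lemma rows_rcons1 u : rows (rcons u 1) = count_mem 2 u :: rows u.
Proof. by rewrite -cats1 rows_cat /= ?addn0. Qed.

Lemma sorted_rows u : sorted geq (rows u).
Proof.
elim/last_ind: u => // u a IH; rewrite -cats1 rows_cat /=.
case: (a == 2) => //=; case: (a == 1) => //=.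
by rewrite addn0 (path_sortedE geq_trans) IH andbT; apply: rows_le.
Qed.

Lemma sorted_cols u : sorted geq (cols u).
Proof.
elim: u => // a u IH /=; case: (a == 2) => //=.
by rewrite (path_sortedE geq_trans) IH andbT; apply: cols_le.
Qed.

(** [nth_rows] and [nth_cols] read off the length of the row (column) that ends
    at a given letter; its index is the number of ones after it (twos before
    it). *)
Lemma nth_rows u w : nth 0 (rows (u ++ 1 :: w)) (count_mem 1 w) = count_mem 2 u.
Proof.
rewrite -cat_rcons rows_cat nth_cat size_map size_rows ltnn subnn.
by rewrite rows_rcons1.
Qed.

Lemma nth_cols u w : nth 0 (cols (u ++ 2 :: w)) (count_mem 2 u) = count_mem 1 w.
Proof.
by rewrite cols_cat nth_cat size_map size_cols ltnn subnn.
Qed.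

Lemma nth_rows_le u w : nth 0 (rows (u ++ w)) (count_mem 1 w) <= count_mem 2 u.
Proof.
rewrite rows_cat nth_cat size_map size_rows ltnn subnn.
by case: (rows u) (rows_le u) => //= a s /andP[].
Qed.

Lemma count_rows u j : count (leq j.+1) (rows u) = nth 0 (cols u) j.
Proof.
elim: u j => [|a u IH] j /=; first by rewrite nth_nil.
case: (eqVneq a 2) => [a2|a2] /=; rewrite ?a2 /=.
  rewrite count_map; case: j => [|j] /=; last by rewrite -IH; apply: eq_count.
  by rewrite -size_rows -count_predT; apply: eq_count.
case: (a == 1); last by rewrite IH.
by rewrite -cats1 count_cat IH /= !addn0.
Qed.

Lemma count_cols u j : count (leq j.+1) (cols u) = nth 0 (rows u) j.
Proof.
elim: u j => [|a u IH] j /=; first by rewrite nth_nil.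
case: (eqVneq a 2) => [a2|a2] /=; rewrite ?a2 /=.
  rewrite -size_rows; case: ltnP => jr.
    by rewrite (nth_map 0) // IH.
  by rewrite IH !nth_default // size_map.
case: (a == 1); rewrite IH // nth_rcons.
by case: ltngtP => // h; rewrite nth_default // ?h // ltnW.
Qed.

(** Conjugation exchanges [rows] and [cols].  The final 1, and the initial 2 in
    [conj_cols], exclude zero entries, which conjugation would drop. *)
Lemma conj_rows u : conj_seq (rows (rcons u 1)) = cols (rcons u 1).
Proof.
have sz : size (cols (rcons u 1)) = count_mem 2 u.
  by rewrite size_cols -cats1 count_cat /= ?addn0.
apply: (@eq_from_nth _ 0) => [|j].
  by rewrite sz size_map size_iota rows_rcons1.
rewrite size_map size_iota => jl; rewrite (nth_map 0) ?size_iota //.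
by rewrite nth_iota // add1n count_rows.
Qed.

Lemma conj_cols u : conj_seq (cols (2 :: u)) = rows (2 :: u).
Proof.
have sz : size (rows (2 :: u)) = count_mem 1 u by rewrite size_rows.
apply: (@eq_from_nth _ 0) => [|j].
  by rewrite sz size_map size_iota.
rewrite size_map size_iota => jl; rewrite (nth_map 0) ?size_iota //.
by rewrite nth_iota // add1n count_cols.
Qed.

(** Inserting or erasing a 1 amounts to adding or removing one row, and likewise
    for a 2 and columns, but the other entries may change places: a permutation
    is what can be stated, and sortedness recovers equality. *)
Lemma perm_rows u w :
  perm_eq (rows (u ++ 1 :: w)) (count_mem 2 u :: rows (u ++ w)).
Proof.
rewrite -cat_rcons !rows_cat rows_rcons1 -cats1 count_cat /= ?addn0.
by rewrite -cat_rcons -cat1s catA perm_cat2r -cats1 perm_catC.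
Qed.

Lemma perm_cols u w :
  perm_eq (cols (u ++ 2 :: w)) (count_mem 1 w :: cols (u ++ w)).
Proof.
rewrite !cols_cat /= -cat_rcons -cat1s catA perm_cat2r -cats1 perm_catC.
by [].
Qed.

(** The word of a partition as a function of the bare list of parts; zero parts
    are allowed here, which makes the inductions below possible. *)
Definition word_of_seq (s : seq nat) : word :=
  flatten [seq rcons (nseq (part s i - part s i.+1) 2) 1
          | i <- rev (iota 1 (size s))].

Lemma word_of_seq_cons a s :
  word_of_seq (a :: s) = word_of_seq s ++ rcons (nseq (a - head 0 s) 2) 1.
Proof.
rewrite /word_of_seq /= rev_cons map_rcons flatten_rcons /part /= nth0.
congr cat.
rewrite (iotaDl 1 1) -map_rev -map_comp; congr flatten.
apply/eq_in_map => i; rewrite mem_rev mem_iota => /andP[]; by case: i.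
Qed.

(** The parts determine a word up to the twos that follow its last 1. *)
Lemma word_of_seq_rows u : binary u ->
  word_of_seq (rows u) ++ nseq (count_mem 2 u - head 0 (rows u)) 2 = u.
Proof.
elim/last_ind: u => // u a IH; rewrite /binary all_rcons => /andP[] + /IH {}IH.
case/orP=> /eqP->.
  rewrite rows_rcons1 word_of_seq_cons /= -(cats1 u) count_cat /= ?addn0.
  rewrite subnn cats0.
  by rewrite -rcons_cat IH cats1.
rewrite -cats1 rows_cat count_cat /= ?addn0 -addnBAC; last first.
  by case: (rows u) (rows_le u) => //= b s /andP[].
by rewrite nseqD catA IH.
Qed.

Lemma count2_word_of_seq s :
  sorted geq s -> count_mem 2 (word_of_seq s) = head 0 s.
Proof.
elim: s => // a s IH sS.
rewrite word_of_seq_cons -cats1 !count_cat IH; last first.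
  exact: path_sorted sS.
have: head 0 s <= a by case: s sS {IH} => //= b s /andP[].
by rewrite count_nseq /=; lia.
Qed.

Lemma rows_word_of_seq s : sorted geq s -> rows (word_of_seq s) = s.
Proof.
elim: s => // a s IH sS; have sS' := path_sorted sS.
rewrite word_of_seq_cons -rcons_cat rows_rcons1 rows_cat count_cat.
rewrite count2_word_of_seq //.
have ha: head 0 s <= a by case: s sS {IH sS'} => //= b s /andP[].
rewrite IH // count_nseq /= mul1n subnKC //; congr (_ :: _).
suff -> : rows (nseq (a - head 0 s) 2) = [::] by [].
by apply: size0nil; rewrite size_rows count_nseq.
Qed.

Lemma word_of_seq_rows_rcons1 u : binary (rcons u 1) ->
  word_of_seq (rows (rcons u 1)) = rcons u 1.
Proof.
move=> /word_of_seq_rows; rewrite rows_rcons1 /= -cats1 count_cat /= !addn0.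
by rewrite subnn cats0.
Qed.

Lemma rows_word_of_part (lam : intpart) : rows (word_of_part lam) = lam.
Proof. by apply: rows_word_of_seq; case: lam => s /= /andP[]. Qed.

Lemma word_of_partE (lam : intpart) u : binary (rcons u 1) ->
  lam = rows (rcons u 1) :> seq nat -> word_of_part lam = rcons u 1.
Proof. by move=> ub lamE; rewrite -[RHS]word_of_seq_rows_rcons1 // -lamE. Qed.

(** * Foata's bijection on words in 1 and 2 *)

Fixpoint before (c : nat) (v : word) : word :=
  if v is a :: v' then
    if (v' != [::]) && (head 0 v' == c) then a :: before c v' else before c v'
  else [::].

Lemma before_cat c x b z :
  before c (x ++ b :: z) = before c (rcons x b) ++ before c (b :: z).
Proof.
elim: x => [|a x IH] //; rewrite [LHS]/= IH.
by case: x {IH} => [|d x] /=; case: (_ == c); rewrite ?if_same.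
Qed.

Lemma before_rcons c x a b :
  before c (rcons (rcons x a) b) =
    if b == c then rcons (before c (rcons x a)) a else before c (rcons x a).
Proof.
rewrite -cats1 cat_rcons before_cat /=.
by case: (b == c); rewrite ?cats1 ?cats0.
Qed.

Lemma before1_mid p a q :
  before 1 (p ++ a :: 1 :: q) = before 1 (rcons p a) ++ a :: before 1 (1 :: q).
Proof. by rewrite before_cat. Qed.

Lemma before2_mid p a q :
  before 2 (p ++ a :: 1 :: q) = before 2 (rcons p a) ++ before 2 (1 :: q).
Proof. by rewrite before_cat. Qed.

Lemma rot_factors_all p w : all p w -> rot_factors p w = w.
Proof.
elim: w => // a w IH /= /andP[pa /IH{}IH].
by have /= -> // := @rot_block p [::] a w; rewrite IH.
Qed.

Lemma rot_factors_pred1 c w :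
  rot_factors (fun a => a == c) (rcons w c) = c :: w.
Proof.
have [n] := ubnP (size w); elim: n w => // n IH w szw.
have [/split_find|nw] := boolP (has (pred1 c) w); last first.
  by rewrite -cats1 rot_block //= ?cats0 // all_predC.
move: szw => + sf; case: sf => b h w2 /eqP -> nh szw.
rewrite rcons_cat cat_rcons rot_block //= ?all_predC //.
rewrite IH ?cat_rcons //; move: szw; rewrite size_cat size_rcons; lia.
Qed.

Lemma eq_rot_factors p q w :
  {in w, p =1 q} -> rot_factors p w = rot_factors q w.
Proof.
rewrite /rot_factors /factors => pq.
suff -> : forall acc, factors_rec p acc w = factors_rec q acc w by [].
elim: w pq => // a w IH pq acc /=; rewrite pq ?mem_head // !IH // => b bw;
  by rewrite pq // inE bw orbT.
Qed.

Lemma binaryP a w : binary w -> a \in w -> (a == 1) || (a == 2).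
Proof. by move=> /allP; apply. Qed.

(** Appending 2: every letter ends a factor, so nothing moves. *)
Lemma foata_step2 w : binary w -> foata_step w 2 = rcons w 2.
Proof.
move=> wb; rewrite /foata_step rot_factors_all // /foata_pred.
case: ifP => [_|]; first by apply: sub_all wb => a; lia.
have : (last 0 w == 0) || (last 0 w \in w).
  by case: w {wb} => //= a w; rewrite mem_last orbT.
by case/orP=> [/eqP->//|/(binaryP wb)]; lia.
Qed.

(** Appending 1: the factors end exactly at the letters equal to the last letter
    b of the word, so moving the last letter of each of them to its front
    carries one b to the front and leaves the rest of the word in order. *)
Lemma foata_step1 w b : binary (rcons w b) ->
  foata_step (rcons w b) 1 = b :: rcons w 1.
Proof.
move=> wb; rewrite /foata_step last_rcons -rcons_cons; congr rcons.
have bb : (b == 1) || (b == 2).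
  by apply: (binaryP wb); rewrite mem_rcons mem_head.
rewrite -(rot_factors_pred1 b).
apply: eq_rot_factors => a /(binaryP wb); rewrite /foata_pred.
by case: ifP; lia.
Qed.

Lemma perm_rot_factors p w : perm_eq (rot_factors p w) w.
Proof.
suff {2}<- : flatten (factors p w) = w.
  rewrite /rot_factors; elim: (factors p w) => //= f fs IH.
  by apply: perm_cat => //; rewrite /rotr perm_rot.
rewrite -[RHS]cat0s /factors; elim: w [::] => [|a w IH] [|b acc] //=.
- by case: ifP => _ /=; rewrite IH.
- by case: ifP => _ /=; rewrite IH /= ?cat_rcons.
Qed.

Lemma perm_phi v : perm_eq (phi v) v.
Proof.
elim/last_ind: v => // v a IH; rewrite phi_rcons /foata_step.
rewrite -!cats1 perm_cat2r; apply: perm_trans IH; exact: perm_rot_factors.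
Qed.

(** By [foata_step1] and [foata_step2], the last letter b of the word built so
    far goes to the front when a 1 arrives and stays in place when a 2
    arrives. *)
Lemma phi_binary v a : binary (rcons v a) ->
  phi (rcons v a)
  = rcons (rev (before 1 (rcons v a)) ++ before 2 (rcons v a)) a.
Proof.
elim/last_ind: v a => // v b IH a vb; rewrite phi_rcons.
have := vb; rewrite {1}/binary all_rcons => /andP[ab vb'].
have := vb'; rewrite -[all _ _](perm_all _ (perm_phi (rcons v b))).
rewrite !before_rcons (IH _ vb'); set X := before 1 _; set Y := before 2 _.
case/orP: ab => /eqP-> XYb.
  by rewrite foata_step1 //= rev_rcons.
by rewrite foata_step2 //= rcons_cat.
Qed.

(** * Pairing ones and twos *)

(** After w has been read, [scan w] is the pair formed by the number of unpaired
    twos and the number of unpaired ones of w. *)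
Definition scan_step (s : nat * nat) (a : nat) : nat * nat :=
  if a == 2 then if s.2 is o.+1 then (s.1, o) else (s.1.+1, 0)
  else (s.1, s.2.+1).

Definition scan (w : word) := foldl scan_step (0, 0) w.

Lemma scan_rcons w a : scan (rcons w a) = scan_step (scan w) a.
Proof. exact: foldl_rcons. Qed.

Lemma scan_mono s w : s.1 <= (foldl scan_step s w).1.
Proof.
elim: w s => // a w IH [t o] /=; apply: leq_trans (IH _).
by rewrite /scan_step /=; case: ifP => _ //; case: o => /=.
Qed.

Lemma scan_cat_mono u w : (scan u).1 <= (scan (u ++ w)).1.
Proof. rewrite /scan foldl_cat; exact: scan_mono. Qed.

Lemma scan_take_mono w i j :
  i <= j -> (scan (take i w)).1 <= (scan (take j w)).1.
Proof.
by move=> ij; rewrite -(cat_take_drop i (take j w)) take_takel // scan_cat_mono.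
Qed.

Lemma scan_count w : binary w ->
  count_mem 2 w + (scan w).2 = count_mem 1 w + (scan w).1.
Proof.
elim/last_ind: w => // w a IH; rewrite /binary all_rcons => /andP[ab /IH].
rewrite scan_rcons -cats1 !count_cat /= !addn0; case: (scan w) => t o /=.
by case/orP: ab => /eqP-> /=; rewrite /scan_step /=; [|case: o => [|o] /=]; lia.
Qed.

(** As long as no further two stays unpaired, the spare one is never used. *)
Lemma scan_turn t o w : (foldl scan_step (t.+1, o) w).1 = t.+1 ->
  foldl scan_step (t, o.+1) w = (t, (foldl scan_step (t.+1, o) w).2.+1).
Proof.
elim: w t o => // a w IH t o /=; rewrite /scan_step /=.
case: ifP => _; last by apply: IH.
case: o => [|o]; last by apply: IH.
by move=> h; have := scan_mono (t.+2, 0) w; rewrite h ltnn.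
Qed.

(** If the displayed 2 is the last unpaired two, then the 1 that replaces it
    stays unpaired, as all the twos of q already find their partners in q. *)
Lemma scan_flip p q : (scan p).2 = 0 ->
  (scan (p ++ 2 :: q)).1 = (scan p).1.+1 ->
  scan (p ++ 1 :: q) = ((scan p).1, (scan (p ++ 2 :: q)).2.+1).
Proof.
rewrite /scan !foldl_cat /= -/(scan p); case: (scan p) => t o /= -> h.
exact: scan_turn.
Qed.

(** The rightmost unpaired two is where the count of unpaired twos reaches its
    final value; just before it, no 1 is left unpaired. *)
Lemma last_unpaired w : 0 < (scan w).1 -> binary w ->
  exists p q, [/\ w = p ++ 2 :: q, (scan p).2 = 0
                & (scan w).1 = (scan p).1.+1].
Proof.
elim/last_ind: w => // w a IH.
rewrite scan_rcons /binary all_rcons => + /andP[ab wb].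
case E: (scan w) IH => [t o] /= IH.
have next : 0 < t -> exists p q,
    [/\ rcons w a = p ++ 2 :: q, (scan p).2 = 0 & t = (scan p).1.+1].
  move=> /IH/(_ wb)[p [q [wE p0 tE]]].
  by exists p, (rcons q a); rewrite {1}wE rcons_cat.
case/orP: ab next => /eqP->; rewrite /scan_step //=.
case: o E => [|o] E next //= _.
by exists w, [::]; rewrite cats1 E.
Qed.

(** A stack machine on letters with positions: an arriving two is cancelled by
    the one on top of the stack, if any.  Its result is not affected by the
    removal of adjacent pairs, so it computes the fully reduced word. *)
Definition push (st : seq (nat * nat)) (y : nat * nat) :=
  if (y.1 == 2) && (head 0 (unzip1 st) == 1) then behead st else y :: st.

Lemma push_remove12 st s : foldl push st (remove12 s) = foldl push st s.
Proof.
have [n] := ubnP (size s); elim: n s st => // n IH [|x [|y s]] st //= sz.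
case: ifP => [/andP[/eqP x1 /eqP y2]|_]; last exact: (IH (y :: s)).
by rewrite IH ?[push st x]/push ?x1 /= /push ?y2 /= ?x1 //=; lia.
Qed.

Lemma remove12_size s : remove12 s = s \/ size (remove12 s) < size s.
Proof.
have [n] := ubnP (size s); elim: n s => // n IH [|x [|y s]] //= sz; try by left.
case: ifP => _ /=; last first.
  by case: (IH (y :: s)) => //= [->|h]; [left|right].
right; case: (IH s) => [|->|]; lia.
Qed.

Lemma remove12_iter n s :
  size s <= n -> remove12 (iter n remove12 s) = iter n remove12 s.
Proof.
elim: n s => [|n IH] s; first by case: s.
rewrite iterSr; case: (remove12_size s) => [sE _|h sn]; last by apply: IH; lia.
have E k : iter k remove12 s = s by elim: k => //= k ->.
by rewrite sE E.
Qed.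

Lemma push_reduced st s : remove12 s = s ->
  ~~ ((head 0 (unzip1 st) == 1) && (head 0 (unzip1 s) == 2)) ->
  foldl push st s = rev s ++ st.
Proof.
elim: s st => // x s IH st; rewrite rev_cons cat_rcons andbC /=.
move=> + hx; have -> : push st x = x :: st by rewrite /push -if_neg hx.
case: s IH => [|y s] IH sE; first by [].
have xy : (x.1 == 1) && (y.1 == 2) = false.
  apply/negP => xy; have := congr1 size sE; rewrite /= xy /=.
  by case: (remove12_size s) => [->|]; lia.
have {}sE : remove12 (y :: s) = y :: s by move: sE; rewrite /= xy => -[].
by rewrite -IH //= xy.
Qed.

Lemma unpairedE w :
  unpaired w = rev (foldl push [::] (zip w (iota 0 (size w)))).
Proof.
rewrite /unpaired; set s := zip _ _.
have <- : foldl push [::] (iter (size w) remove12 s) = foldl push [::] s.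
  by elim: (size w) => //= k IH; rewrite push_remove12.
rewrite push_reduced ?cats0 ?revK // remove12_iter //.
by rewrite size_zip size_iota minnn.
Qed.

Definition ones (s : seq (nat * nat)) := all (fun y => y.1 == 1) s.
Definition twos (s : seq (nat * nat)) := all (fun y => y.1 == 2) s.

(** The stack holds unpaired ones above unpaired twos, and a two that has
    entered it never leaves. *)
Lemma push_scan o2 t2 s : ones o2 -> twos t2 -> binary (unzip1 s) ->
  exists o n, [/\ foldl push (o2 ++ t2) s = o ++ n ++ t2, ones o, twos n
    & foldl scan_step (size t2, size o2) (unzip1 s)
      = (size n + size t2, size o)].
Proof.
elim: s o2 t2 => [|[a i] s IH] o2 t2 ho ht /=; first by exists o2, [::].
case/andP=> /orP[]/eqP-> sb.
  exact: (IH ((1, i) :: o2)).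
rewrite /push /scan_step /=; case: o2 ho => [|[b j] o2] /=; last first.
  move=> /andP[/eqP/= -> ho]; rewrite eqxx.
  exact: IH.
move=> _; have -> : (head 0 (unzip1 t2) == 1) = false.
  by case: t2 ht => //= y t2 /andP[/eqP->].
have [o [n [/= -> ? ? ->]]] := IH [::] ((2, i) :: t2) isT ht sb.
exists o, (rcons n (2, i)); split=> //; first by rewrite cat_rcons.
  by rewrite /twos all_rcons eqxx.
by rewrite size_rcons addSnnS.
Qed.

Lemma unpaired2E w : unpaired2 w =
  rev [seq x.2 | x <- foldl push [::] (zip w (iota 0 (size w))) & x.1 == 2].
Proof. by rewrite /unpaired2 unpairedE filter_rev map_rev. Qed.

Lemma ones_twos o n : ones o -> twos n -> [seq x <- o ++ n | x.1 == 2] = n.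
Proof.
move=> ho /all_filterP hn; rewrite filter_cat hn.
suff -> : [seq x <- o | x.1 == 2] = [::] by [].
by elim: o ho => //= x o IH /andP[/eqP-> /IH].
Qed.

Lemma size_unpaired2 w : binary w -> size (unpaired2 w) = (scan w).1.
Proof.
move=> wb; set s := zip w (iota 0 (size w)).
have sE : unzip1 s = w by rewrite unzip1_zip // size_iota.
have [|||o [n [sP ho hn]]] := @push_scan [::] [::] s; rewrite ?sE //.
rewrite unpaired2E sP cats0 ones_twos // addn0 /scan => -> /=.
by rewrite size_rev size_map.
Qed.

(** The position pushed when the displayed 2 is read is the topmost two of the
    final stack. *)
Lemma gamma_flip p q : binary (p ++ 2 :: q) -> (scan p).2 = 0 ->
  (scan (p ++ 2 :: q)).1 = (scan p).1.+1 -> gamma (p ++ 2 :: q) = p ++ 1 :: q.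
Proof.
move=> wb p0 tE; have := wb; rewrite /binary all_cat => /and3P[pb _ qb].
suff [l lE] : exists l, unpaired2 (p ++ 2 :: q) = rcons l (size p).
  rewrite /gamma lE; have -> : forall A, (if rcons l (size p) is i :: s then
    set_nth 0 (p ++ 2 :: q) (last i s) 1 else A) =
    set_nth 0 (p ++ 2 :: q) (size p) 1.
    by move=> A; case: l {lE} => //= i l; rewrite last_rcons.
  by elim: p {wb p0 tE pb lE} => //= a p ->.
rewrite unpaired2E size_cat iotaD zip_cat ?size_iota //= foldl_cat /=.
have sE : unzip1 (zip p (iota 0 (size p))) = p.
  by rewrite unzip1_zip // size_iota.
have [|||o [n [-> ho hn]]] := @push_scan [::] [::] (zip p (iota 0 (size p)));
  rewrite ?sE //.
rewrite cats0 addn0 /= -/(scan p) => sp.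
have o0 : o = [::] by apply: size0nil; move: p0; rewrite sp.
move: sp; rewrite {}o0 /= => sp.
have -> : push n (2, size p) = (2, size p) :: n.
  by rewrite /push /=; case: (n) hn => //= y n' /andP[/eqP->].
set s := zip q _.
have sqE : unzip1 s = q by rewrite unzip1_zip // size_iota.
have [|||o' [n' [-> ho' hn']]] := @push_scan [::] ((2, size p) :: n) s;
  rewrite ?sqE //.
move: tE; rewrite /scan foldl_cat /= -/(scan p) sp {1}/scan_step /= => tE.
move=> /(congr1 fst); rewrite /= tE => nE.
have -> : n' = [::] by apply: size0nil; lia.
rewrite ones_twos //= rev_cons; by exists (rev (map snd n)).
Qed.

(** [pred1] and [count] introduce distinct but convertible forms of the type
    nat, which make equal counts look different to lia. *)
Ltac count_lia :=
  change (Equality.sort Datatypes_nat__canonical__eqtype_Equality) with nat in *;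
  lia.

(** * Peaks of v and the numbers r_i *)

Definition desc (v : word) := count_mem 2 (before 1 v).

Lemma count_before c v a : binary (rcons v a) ->
  count_mem c (before 1 (rcons v a)) + count_mem c (before 2 (rcons v a))
  = count_mem c v.
Proof.
move=> vb; have /permP/(_ (pred1 c)) := perm_phi (rcons v a).
rewrite phi_binary // -!cats1 !count_cat count_rev /=; lia.
Qed.

(** Ascents and descents alternate. *)
Lemma asc_desc a v : binary (a :: v) ->
  count_mem 1 (before 2 (a :: v)) + (a == 2) = desc (a :: v) + (last a v == 2).
Proof.
rewrite /desc; elim: v a => [|b v IH] a //= /andP[ab vb].
have := IH b vb; case/andP: vb => bb _ /=.
by case/orP: ab => /eqP->; case/orP: bb => /eqP-> /=; lia.
Qed.

(** In a word that starts with 1, the first letter followed by a 2 is a 1.  Hence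
    in phi v no 2 separates the letters contributed by the part of v up to a
    peak from the 1 that ends the row of that peak. *)
Lemma before2_head q : binary q ->
  exists W, rcons (before 2 (1 :: q)) 1 = 1 :: W.
Proof.
elim: q => [|b q IH] //=; first by exists [::].
case/andP=> /orP[] /eqP-> qb; first by case: (IH qb) => W /= ->; exists W.
by rewrite /=; eexists.
Qed.

Lemma desc_peak v j : j < desc v ->
  exists p q, v = p ++ 2 :: 1 :: q /\ desc (1 :: q) = j.
Proof.
elim: v => // a v IH; case: v IH => [|b v] // IH.
have step : j < desc (b :: v) ->
    exists p q, a :: b :: v = p ++ 2 :: 1 :: q /\ desc (1 :: q) = j.
  by move=> /IH[p [q [-> <-]]]; exists (a :: p), q.
rewrite {1}/desc [before 1 _]/=; case: (eqVneq b 1) => [b1|] //= in step *.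
case: (eqVneq a 2) => [a2|] //= in step *; rewrite ?add0n //.
rewrite add1n ltnS leq_eqVlt => /orP[/eqP jE|//].
by exists [::], v; rewrite jE a2 b1.
Qed.

(** Peaks further to the left have larger indices. *)
Lemma desc_drop v i j : i <= j -> desc (drop j v) <= desc (drop i v).
Proof.
move=> /subnK <-; rewrite -drop_drop; elim: (j - i) (drop i v) => [|k IH] w.
  by rewrite drop0.
case: w => //= a w; apply: leq_trans (IH w) _.
by rewrite /desc /=; case: ifP => //= _; rewrite leq_addl.
Qed.

Section Peaks.

Variables (lam : intpart) (v : word).
Hypothesis vb : binary (rcons v 1).
Hypothesis lamE : word_of_part lam = phi (rcons v 1).

Let lam_rows :
  lam = rows (rcons (rev (before 1 (rcons v 1)) ++ before 2 (rcons v 1)) 1)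
    :> seq nat.
Proof. by rewrite -phi_binary // -lamE rows_word_of_part. Qed.

Lemma conj_lam : conj lam = cols (phi (rcons v 1)) :> seq nat.
Proof. by rewrite /= lam_rows conj_rows phi_binary. Qed.

(** Let m be the number of descents of 1q.  In phi v, the two of the peak has
    exactly m twos on its left, and the word after the letters contributed by p2
    starts with a 1 that has exactly m ones on its right.  So these two letters
    end the column and the row of index m + 1. *)
Lemma peak_parts p q : rcons v 1 = p ++ 2 :: 1 :: q ->
  part lam (desc (1 :: q)).+1 = (desc (1 :: q)).+1 + count_mem 2 p /\
  part (conj lam) (desc (1 :: q)).+1 = (desc (1 :: q)).+1 + count_mem 1 p.
Proof.
move=> vE; have /andP[pb qb] : binary p && binary q.
  by have := vb; rewrite vE /binary all_cat.
have last1 : last 1 q = 1.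
  by have := congr1 (last 0) vE; rewrite last_rcons last_cat.
have p2b : binary (rcons p 2) by rewrite /binary all_rcons.
have asc := @asc_desc 1 q qb; rewrite last1 !addn0 in asc.
have [W WE] := before2_head qb.
have cW : count_mem 1 W = desc (1 :: q).
  have := congr1 (count_mem 1) WE; rewrite -cats1 count_cat [RHS]/= asc /=; lia.
have c1 := count_before 1 p2b; have c2 := count_before 2 p2b.
rewrite /part conj_lam lam_rows phi_binary // vE before1_mid before2_mid.
set m := desc (1 :: q) in asc cW *.
set f := before 1 (rcons p 2) in c1 c2 *.
set g := before 2 (rcons p 2) in c1 c2 *.
have dE : count_mem 2 (before 1 (1 :: q)) = m by [].
split; rewrite succnK.
  rewrite !rcons_cat WE catA -{1}cW nth_rows.
  rewrite count_cat count_rev count_cat -cat1s count_cat dE /=; count_lia.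
rewrite rev_cat rev_cons cat_rcons -!catA rcons_cat rcons_cons.
rewrite -{1}dE -count_rev nth_cols -cats1 !count_cat count_rev asc /=.
count_lia.
Qed.

Lemma rdiff_peak p q : rcons v 1 = p ++ 2 :: 1 :: q ->
  rdiff lam (desc (1 :: q)).+1
  = ((count_mem 2 p)%N%:Z - (count_mem 1 p)%N%:Z)%R.
Proof. by move=> /peak_parts[E1 E2]; rewrite /rdiff E1 E2; count_lia. Qed.

(** The part of index D, for D the number of descents, belongs to the leftmost
    peak and is at least D by [peak_parts]; the next part is at most D, because
    phi v splits into a prefix with D twos and a suffix with D ones. *)
Lemma durfee_desc : durfee lam = desc (rcons v 1).
Proof.
set D := desc _.
have le_D : nth 0 lam D <= D.
  have D2 : count_mem 2 (rev (before 1 (rcons v 1))) = D by rewrite count_rev.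
  rewrite lam_rows rcons_cat; case: v vb @D D2 => [|a w] awb D D2; first by [].
  have := @asc_desc a (rcons w 1) awb.
  rewrite last_rcons addn0 -/(rcons (a :: w) 1) -/D => asc.
  have /andP[/orP[]/eqP aE wb] :
    ((a == 1) || (a == 2)) && binary (rcons w 1) := awb.
    (* If v starts with 1, there are D + 1 ones in the second half, which then
       starts with a 1: that letter ends the row of index D + 1. *)
    have [W WE] := before2_head wb; move: asc D2.
    rewrite aE rcons_cons WE addn0 => asc D2.
    have cW : count_mem 1 W = D.
      have := congr1 (count_mem 1) WE; rewrite -cats1 count_cat asc addnC.
      by move=> /eqP; rewrite (eqn_add2l 1) eq_sym => /eqP.
    by rewrite -[X in nth _ _ X]cW nth_rows D2.
  have cB : count_mem 1 (rcons (before 2 (rcons (a :: w) 1)) 1) = D.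
    by rewrite -cats1 count_cat -asc aE.
  by rewrite -[X in nth _ _ X]cB -[X in _ <= X]D2 nth_rows_le.
have ge_D : D <= size lam /\ all (leq D) (take D lam).
  case: (posnP D) => [->|D0]; first by rewrite take0.
  have [|p [q [vE qE]]] := @desc_peak (rcons v 1) D.-1; first by rewrite prednK.
  have [+ _] := peak_parts vE; rewrite qE prednK // /part => nD.
  have szD : D <= size lam.
    rewrite -(prednK D0) ltnNge; apply/negP => h; move: nD.
    by rewrite nth_default //; lia.
  split=> //; apply/(all_nthP 0) => i; rewrite size_takel // => iD.
  rewrite nth_take //; apply: (@leq_trans (nth 0 lam D.-1)).
    by rewrite nD leq_addr.
  rewrite lam_rows; apply: (sorted_leq_nth geq_trans leqnn 0 (sorted_rows _));
    rewrite ?inE -?lam_rows; lia.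
apply/eqP; rewrite eqn_leq; apply/andP; split.
  apply/bigmax_leqP => k /(all_nthP 0) hk; rewrite leqNgt; apply/negP => Dk.
  have kl : k <= size lam by rewrite -ltnS.
  by have := hk D; rewrite size_takel // nth_take // => /(_ Dk); lia.
have [szD allD] := ge_D.
by rewrite -ltnS in szD; exact: (bigop.bigmax_sup (Ordinal szD)).
Qed.

End Peaks.

(** * One round of the loop *)

Lemma rmax_le (lam : intpart) (m : int) : (-1 <= m)%R ->
  (forall j, 0 < j <= durfee lam -> (rdiff lam j <= m)%R) -> (rmax lam <= m)%R.
Proof.
move=> m1 mP; rewrite /rmax; case: eqP => // /eqP; rewrite -lt0n => d0.
by rewrite big_nat_cond; apply: bigmax_le => [|j]; rewrite ?andbT; exact: mP.
Qed.

Lemma rdiff_le_rmax (lam : intpart) j : 0 < j <= durfee lam ->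
  (rdiff lam j <= rmax lam)%R.
Proof.
case/andP=> j0 jd; rewrite /rmax; case: eqP => [d0|_].
  by move: (leq_trans j0 jd); rewrite d0.
by apply: le_bigmax_seq => //; rewrite mem_index_iota j0.
Qed.

Lemma csv_indexE (lam : intpart) i :
  0 < i <= durfee lam -> (0 <= rdiff lam i)%R ->
  (forall j, 0 < j <= durfee lam -> (rdiff lam j <= rdiff lam i)%R) ->
  (forall j, i < j <= durfee lam -> (rdiff lam j < rdiff lam i)%R) ->
  csv_index lam = i /\ rmax lam = rdiff lam i.
Proof.
move=> id r0 le_r lt_r.
have rE : rmax lam = rdiff lam i.
  by apply/le_anti; rewrite rdiff_le_rmax // andbT rmax_le //; apply: le_trans r0.
split=> //; rewrite /csv_index rE.
apply/eqP; rewrite eqn_leq; apply/andP; split.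
  apply/bigmax_leqP_seq => j; rewrite mem_index_iota => /andP[j0 jd] /eqP jE.
  rewrite leqNgt; apply/negP => ij.
  by have := lt_r j; rewrite ij jE ltxx => /(_ jd).
by apply: leq_bigmax_seq; rewrite ?mem_index_iota ?eqxx.
Qed.

Section Index.

Variables (lam : intpart) (v : word).
Hypothesis vb : binary (rcons v 1).
Hypothesis lamE : word_of_part lam = phi (rcons v 1).

Let peakE p q : rcons v 1 = p ++ 2 :: 1 :: q ->
  rdiff lam (desc (1 :: q)).+1 = ((scan p).1%:Z - (scan p).2%:Z)%R
  /\ (scan (rcons p 2)).1 <= (scan v).1.
Proof.
move=> vE; split.
  rewrite (rdiff_peak vb lamE vE).
  have := @scan_count p; case: (scan p) => t o /=.
  have -> : binary p by move: vb; rewrite vE /binary all_cat => /andP[].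
  by move=> /(_ isT); count_lia.
have -> : (scan v).1 = (scan (rcons v 1)).1 by rewrite scan_rcons.
by rewrite vE -cat_rcons scan_cat_mono.
Qed.

Let peak_exists j : 0 < j <= durfee lam ->
  exists p q, rcons v 1 = p ++ 2 :: 1 :: q /\ j = (desc (1 :: q)).+1.
Proof.
case: j => // j /=; rewrite (durfee_desc vb lamE) => jd.
by have [p [q [vE <-]]] := desc_peak jd; exists p, q.
Qed.

Let scan_rcons2 p : (scan p).1 < (scan (rcons p 2)).1 + (scan p).2.
Proof.
by rewrite scan_rcons; case: (scan p) => t [|o]; rewrite /scan_step /=; lia.
Qed.

Lemma rdiff_lt j : 0 < j <= durfee lam -> (rdiff lam j < (scan v).1%:Z)%R.
Proof.
move=> /peak_exists[p [q [vE ->]]]; have [-> h] := peakE vE.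
have := scan_rcons2 p; lia.
Qed.

Lemma rmax_ballot : (scan v).1 = 0 -> (rmax lam < 0)%R.
Proof.
move=> v0; have : (rmax lam <= -1)%R; last by lia.
by apply: rmax_le => // j /rdiff_lt; rewrite v0; lia.
Qed.

(** Every r_j is less than the number of unpaired twos of v, and the peak at the
    rightmost unpaired two reaches the largest value that this leaves, because
    every 1 of p is paired.  A peak with a larger index lies inside p, which has fewer unpaired
    twos, so its value is strictly smaller. *)
Lemma csv_index_last_unpaired p q :
    v = p ++ 2 :: 1 :: q -> (scan p).2 = 0 -> (scan v).1 = (scan p).1.+1 ->
  csv_index lam = (desc (1 :: rcons q 1)).+1 /\ (0 <= rmax lam)%R.
Proof.
move=> vE p0 tE; have vE' : rcons v 1 = p ++ 2 :: 1 :: rcons q 1.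
  by rewrite vE rcons_cat.
have [rE _] := peakE vE'; set i := desc _ in rE *.
have id : 0 < i.+1 <= durfee lam.
  rewrite (durfee_desc vb lamE) vE' /desc before1_mid count_cat.
  rewrite -cat1s count_cat /= -/(desc (1 :: rcons q 1)); count_lia.
rewrite p0 subr0 in rE.
have [|j /rdiff_lt|j ij|-> ->] := csv_indexE id; rewrite rE ?tE //.
have [|p' [q' [wE jE]]] := @peak_exists j; first by lia.
rewrite {1}jE; have [-> _] := peakE wE.
have pp : size p' < size p.
  rewrite ltnNge; apply/negP => h.
  have := @desc_drop (rcons v 1) (size p).+1 (size p').+1 h.
  rewrite {1}wE vE' !drop_cat !ltnNge !leqW // !subSn // !subnn /= -/i; lia.
have := scan_take_mono (rcons v 1) pp.
rewrite {1}wE vE' (@take_size_cat _ (size p)) // take_cat ltnNge leqnSn subSnn.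
rewrite /= cats1.
have := scan_rcons2 p'; lia.
Qed.

End Index.

Lemma sorted_geq_perm (s1 s2 : seq nat) :
  sorted geq s1 -> sorted geq s2 -> perm_eq s1 s2 -> s1 = s2.
Proof.
apply: sorted_eq; first exact: geq_trans.
by move=> a b /= ab; apply/eqP; rewrite eqn_leq andbC.
Qed.

(** The three moves of a round, read on words.  The column to remove has length
    i = |2X|_2 + 1 = |Y1|_1, which is the length of the column that ends at the
    displayed 2; the new 1 has i - 1 twos on its left; the 2 inserted before the
    last 1 lengthens the first row.  The initial 2 is what keeps i - 1
    positive, and what lets the conjugate be read off again after the
    removal. *)
Lemma csv_step_word (lam : intpart) X Z Y :
    binary (rcons (2 :: X ++ Z ++ 2 :: Y) 1) ->
    word_of_part lam = rcons (2 :: X ++ Z ++ 2 :: Y) 1 ->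
    count_mem 1 Y = (count_mem 2 X).+1 -> csv_index lam = (count_mem 2 X).+2 ->
  csv_index lam \in (conj lam : seq nat) /\
  word_of_part (csv_step lam) = rcons (rcons (2 :: X ++ 1 :: Z ++ Y) 2) 1.
Proof.
set u := 2 :: _ => ub lamE cY iE.
have cE : conj lam = cols (rcons u 1) :> seq nat.
  by rewrite /= -(rows_word_of_part lam) lamE conj_rows.
set u' := rcons (2 :: X ++ Z ++ Y) 1.
have permC : perm_eq (conj lam) (csv_index lam :: cols u').
  have -> : csv_index lam = count_mem 1 (rcons Y 1).
    by rewrite iE -cats1 count_cat cY /= addn0 addn1.
  rewrite cE; have := perm_cols (2 :: X ++ Z) (rcons Y 1).
  by rewrite /u /u' -!cats1 /= -!catA.
have iC : csv_index lam \in (conj lam : seq nat).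
  by rewrite (perm_mem permC) mem_head.
split=> //; set i := csv_index lam in iE permC iC *.
have remE : rem_part i (conj lam) = cols u' :> seq nat.
  apply: sorted_geq_perm; first by case: (rem_part _ _) => s /= /andP[].
    exact: sorted_cols.
  rewrite -(perm_cons i); apply: perm_trans permC.
  by rewrite perm_sym; apply: perm_to_rem.
set w := rcons (2 :: X ++ 1 :: Z ++ Y) 1.
have addE : add_part i.-1 (conj (rem_part i (conj lam))) = rows w :> seq nat.
  apply: sorted_geq_perm; first by case: (add_part _ _) => s /= /andP[].
    exact: sorted_rows.
  have conjE : conj (rem_part i (conj lam)) = rows u' :> seq nat.
    by rewrite [LHS]/= -[rem _ _]/(rem_part i (conj lam) : seq nat) remE conj_cols.
  have addP (mu : intpart) :
    perm_eq (add_part i.-1 mu) ((count_mem 2 X).+1 :: mu).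
    by rewrite iE /= perm_sort.
  apply: perm_trans (addP _) _; rewrite conjE perm_sym.
  have := perm_rows (2 :: X) (rcons (Z ++ Y) 1).
  by rewrite -rcons_cons -!rcons_cat.
have stepE :
  csv_step lam = rows (rcons (rcons (2 :: X ++ 1 :: Z ++ Y) 2) 1) :> seq nat.
  set mu := add_part i.-1 (conj (rem_part i (conj lam))) in addE.
  rewrite /csv_step -/i [LHS]/= -[add_part_seq _ _]/(mu : seq nat).
  rewrite addE /w !rows_rcons1 -[rcons _ 2]cats1 rows_cat count_cat.
  by rewrite /= addn1.
apply: word_of_partE stepE; move: ub.
rewrite /binary /u !all_rcons /= !all_cat /= !all_cat.
by case/and3P=> -> -> ->.
Qed.

(** Changing the 2 into a 1 affects the closed form of phi in two places.  The
    letter itself was followed by 1 and still is, so it becomes a 1 inside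
    the reversed half.  If p is not empty, then it ends with a 2, as it has no
    unpaired one; this 2 was followed by a 2 and is now followed by a 1, so it
    moves from the end of its block in the second half to the place next to the
    new 1.  The 2 inserted before the final 1 adds a 2 at the end of the second
    half. *)
Lemma phi_flip p q (X := rev (before 1 (1 :: rcons q 2)))
    (Y := before 2 (1 :: rcons q 2)) :
    binary (p ++ 2 :: 1 :: rcons q 2) -> (scan p).2 = 0 ->
  exists Z, phi (rcons (p ++ 2 :: 1 :: rcons q 2) 1)
      = rcons (2 :: X ++ Z ++ 2 :: Y) 1
    /\ phi (rcons (rcons (p ++ 1 :: 1 :: rcons q 2) 2) 1)
       = rcons (rcons (2 :: X ++ 1 :: Z ++ Y) 2) 1.
Proof.
move=> vb p0; have [pb rb] : binary p /\ binary (rcons q 2).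
  by apply/andP; move: vb; rewrite /binary all_cat.
have b1 : binary (rcons (p ++ 2 :: 1 :: rcons q 2) 1).
  by rewrite /binary all_rcons.
have b2 : binary (rcons (rcons (p ++ 1 :: 1 :: rcons q 2) 2) 1).
  by rewrite /binary !all_rcons /= all_cat; apply/andP.
have B1 : before 1 (rcons (p ++ 2 :: 1 :: rcons q 2) 1) =
    before 1 (rcons p 2) ++ 2 :: rcons (before 1 (1 :: rcons q 2)) 2.
  by rewrite rcons_cat before1_mid (before_rcons 1 (1 :: q)).
have B2 : before 2 (rcons (p ++ 2 :: 1 :: rcons q 2) 1) =
    before 2 (rcons p 2) ++ Y.
  by rewrite rcons_cat before2_mid (before_rcons 2 (1 :: q)).
have B3 : before 1 (rcons (rcons (p ++ 1 :: 1 :: rcons q 2) 2) 1) =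
    before 1 (rcons p 1) ++ 1 :: rcons (before 1 (1 :: rcons q 2)) 2.
  rewrite before_rcons eqxx rcons_cat before1_mid (before_rcons 1 (1 :: q)) /=.
  by rewrite rcons_cat.
have B4 : before 2 (rcons (rcons (p ++ 1 :: 1 :: rcons q 2) 2) 1) =
    rcons (before 2 (rcons p 1) ++ Y) 2.
  rewrite before_rcons rcons_cat before2_mid (before_rcons 2 (1 :: q)) /=.
  by rewrite rcons_cat.
rewrite !phi_binary // B1 B2 B3 B4 !rev_cat !rev_cons !rev_rcons -/X.
case/lastP: p p0 pb {vb b1 b2 B1 B2 B3 B4} => [|p a].
  by exists [::]; rewrite -!cats1 /= -!catA.
rewrite scan_rcons /binary all_rcons => + /andP[ab _]; move: ab.
case/orP=> /eqP->; first by rewrite /scan_step.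
move=> _; rewrite !before_rcons /= rev_rcons.
(* Z records the last 2 of p, moved next to the new 1, and the rest of p. *)
exists (2 :: rev (before 1 (rcons p 2)) ++ before 2 (rcons p 2)).
by split; rewrite -!cats1 /= -!catA /= -!catA.
Qed.

Lemma csv_step_flip (lam : intpart) p q (v := p ++ 2 :: 1 :: rcons q 2) :
    binary v -> (scan p).2 = 0 -> (scan v).1 = (scan p).1.+1 ->
    word_of_part lam = phi (rcons v 1) ->
  [/\ (0 <= rmax lam)%R, csv_index lam \in (conj lam : seq nat)
    & word_of_part (csv_step lam)
      = phi (rcons (rcons (p ++ 1 :: 1 :: rcons q 2) 2) 1)].
Proof.
move=> vb p0 tE lamE.
have vb1 : binary (rcons v 1) by rewrite /binary all_rcons.
have [iE r0] := csv_index_last_unpaired vb1 lamE (erefl v) p0 tE.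
have [Z [phiE phiE']] := phi_flip vb p0.
have rb : binary (1 :: rcons q 2).
  by move: vb; rewrite /v /binary all_cat => /andP[].
have := asc_desc rb; rewrite last_rcons eqxx addn0 addn1.
set X := rev _ in phiE phiE' *; set Y := before 2 _ in phiE phiE' *.
have dX : desc (1 :: rcons q 2) = count_mem 2 X by rewrite count_rev.
rewrite dX => cY.
have iE' : csv_index lam = (count_mem 2 X).+2.
  rewrite iE -dX /desc (before_rcons 1 (1 :: q) 2 1) eqxx -cats1 count_cat.
  by rewrite addn1.
rewrite phiE in lamE.
have [] := csv_step_word _ lamE cY iE'; last by rewrite -phiE'.
by rewrite -phiE /binary (perm_all _ (perm_phi _)).
Qed.

(** * The theorem *)

Lemma scan_cat_tail x j : j <= (scan x).2 ->
  (scan (x ++ 1 :: nseq j.+1 2)).1 = (scan x).1.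
Proof.
have twos t o k : foldl scan_step (t, o + k) (nseq k 2) = (t, o).
  by elim: k => [|k IH] /=; rewrite ?addn0 // addnS /scan_step.
move=> jo; rewrite /scan foldl_cat -/(scan x); case: (scan x) jo => t o /= jo.
rewrite -[foldl _ _ _]/(foldl scan_step (t, o.+1) (nseq j.+1 2)).
by rewrite -{1}(subnK jo) -addnS twos.
Qed.

(** In a run of CSV that starts from phi (y 1 2 1), the partition reached after
    j rounds has the word phi (x 1 2^(j+1) 1), where x is the result of j
    applications of gamma to y.  The j twos added so far are paired with
    the j ones that gamma created, whence the hypothesis on [scan x]; so the
    rightmost unpaired two of the whole word is that of x. *)
Lemma CSV_iter_gamma t x j (lam : intpart) :
    binary x -> (scan x).1 = t -> j <= (scan x).2 ->
    word_of_part lam = phi (rcons (x ++ 1 :: nseq j.+1 2) 1) ->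
  exists mu, CSV lam mu /\
    word_of_part mu = phi (rcons (iter t gamma x ++ 1 :: nseq (t + j).+1 2) 1).
Proof.
elim: t x j lam => [|t IH] x j lam xb tE jo lamE.
  exists lam; split=> //; apply: CSV_stop.
  apply: rmax_ballot lamE _.
    by rewrite /binary all_rcons all_cat -/(binary x) xb /= all_nseq orbT.
  by rewrite scan_cat_tail.
have x0 : 0 < (scan x).1 by rewrite tE.
have [p [q [xE p0 tpE]]] := last_unpaired x0 xb.
have twosE : nseq j.+1 2 = rcons (nseq j 2) 2.
  by rewrite -cats1 -(nseqD _ 1) addn1.
have [q' qE] : exists q', q ++ 1 :: nseq j.+1 2 = 1 :: rcons q' 2.
  case: q xE => [|b q] xE; first by exists (nseq j 2); rewrite twosE.
  exists (q ++ 1 :: nseq j 2); rewrite twosE rcons_cat /=; congr (_ :: _).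
  have : (b == 1) || (b == 2).
    by apply: (binaryP xb); rewrite xE mem_cat !inE eqxx !orbT.
  (* A 2 directly after the rightmost unpaired two would be unpaired too. *)
  case/orP=> /eqP // b2; rewrite b2 in xE.
  have := scan_cat_mono (rcons (rcons p 2) 2) q.
  rewrite !cat_rcons -xE tpE !scan_rcons.
  by case: (scan p) p0 => t' o /= ->; rewrite /scan_step /= ltnn.
have vE : x ++ 1 :: nseq j.+1 2 = p ++ 2 :: 1 :: rcons q' 2.
  by rewrite xE -catA /= qE.
have vb : binary (p ++ 2 :: 1 :: rcons q' 2).
  by rewrite -vE /binary all_cat -/(binary x) xb /= all_nseq orbT.
have tv : (scan (p ++ 2 :: 1 :: rcons q' 2)).1 = (scan p).1.+1.
  by rewrite -tpE -vE scan_cat_tail.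
rewrite vE in lamE; have [r0 iC stepE] := csv_step_flip vb p0 tv lamE.
have gE : gamma x = p ++ 1 :: q by rewrite xE gamma_flip -?xE.
have sE : scan (gamma x) = (t, (scan x).2.+1).
  by rewrite gE xE scan_flip -?xE //; congr (_, _); rewrite tpE in tE; case: tE.
have gb : binary (gamma x).
  by move: xb; rewrite gE xE /binary !all_cat.
have [|||mu [muC muE]] := IH (gamma x) j.+1 (csv_step lam) gb.
- by rewrite sE.
- by rewrite sE.
- rewrite stepE gE; congr (phi (rcons _ 1)).
  by rewrite -catA /= -qE rcons_cat /= rcons_cat /= -cats1 -(nseqD _ 1) addn1.
by exists mu; split; [apply: CSV_loop|rewrite muE -iterSr addnS].
Qed.

Lemma binary_word_of_part (lam : intpart) : binary (word_of_part lam).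
Proof.
rewrite /binary /word_of_part; elim: (rev _) => //= i s IH.
by rewrite all_cat IH all_rcons all_nseq orbT.
Qed.

Lemma D0_word (lam : intpart) : lam \in D_0 ->
  word_of_part lam = [::] \/
  exists u, word_of_part lam = rcons (rcons u 1) 1 /\
    head 0 (word_of_part lam) = 2.
Proof.
move=> lamD.
have wE : word_of_part lam = word_of_seq lam by [].
have hE : word_of_part lam != [::] -> head 0 (word_of_part lam) = 2.
  have := rows_word_of_part lam; have := binary_word_of_part lam.
  case: (word_of_part lam) => //= a w /andP[/orP[]/eqP-> _] // lamE _.
  case: lam lamE {lamD wE} => s /= /andP[_ /negP s0] sE; case: s0.
  by rewrite -sE mem_rcons mem_head.
case: lam lamD wE hE => -[|a s] sP; first by left.
rewrite inE /part /= => /eqP aE wE hE; right.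
case: s sP aE wE hE => [|b s] sP aE wE hE.
  by exfalso; have /andP[_] := sP; rewrite aE mem_head.
exists (word_of_seq s ++ nseq (b - head 0 s) 2); split; last first.
  by apply: hE; rewrite -size_eq0 wE word_of_seq_cons size_cat size_rcons addnS.
rewrite wE !word_of_seq_cons aE /= subnn /= cats1; congr rcons.
by rewrite -rcons_cat.
Qed.

(** The closed form of phi determines the end of w: its last letter is the last
    letter of phi w; the letter before, being followed by a 1, comes first in
    phi w; the one before that, being followed by a 2, comes last but one. *)
Lemma phi_inv_D0 u w :
  binary (rcons (rcons u 1) 1) -> head 0 (rcons (rcons u 1) 1) = 2 ->
  phi w = rcons (rcons u 1) 1 -> exists x, w = x ++ [:: 1; 2; 1].
Proof.
set v := rcons _ 1 => vb hv wE; have wb : binary w.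
  by rewrite /binary -(perm_all _ (perm_phi w)) wE.
have sz : size w = (size u).+2 by rewrite -size_phi wE !size_rcons.
case/lastP: w sz wE wb => // w c.
case/lastP: w => [|w d]; first by rewrite size_rcons.
rewrite !size_rcons => -[sz] wE wb; move: (wE).
rewrite phi_binary // => /rcons_inj[+ c1]; rewrite {}c1 in wE wb *.
rewrite !before_rcons eqxx rev_rcons => uE.
have d2 : d = 2 by move: hv; rewrite /v -uE.
rewrite {}d2 in wE wb uE *; case/lastP: w sz wE wb uE => [|w e] sz wE wb.
  by case: (u) sz hv.
rewrite !before_rcons /= -rcons_cat -rcons_cons => /rcons_inj[_ ->].
by exists w; rewrite -!cats1 -!catA.
Qed.

Theorem theorem5p5 (lam : intpart) (lamD : lam \in D_0) :
  exists mu : intpart,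
    [/\ mu \in R_le_m1, CSV lam mu
      & word_of_part mu = phi (GK (phi_inv (word_of_part lam)))].
Proof.
case: (D0_word lamD) => [lam0|[u [lamE hE]]].
  exists lam; have C : CSV lam lam.
    apply: CSV_stop; rewrite /rmax.
    suff -> : durfee lam = 0 by [].
    apply/eqP; rewrite -leqn0; apply/bigmax_leqP => k _.
    have := size_rows (word_of_part lam).
    rewrite rows_word_of_part lam0 /= => sz.
    by rewrite -sz -ltnS.
  by split=> //; [apply: CSV_range C|rewrite lam0].
set v := phi_inv _; have vE : phi v = word_of_part lam by rewrite phi_invK.
have [|||x xE] := @phi_inv_D0 u v; rewrite -?lamE //.
  exact: binary_word_of_part.
have vb : binary v.
  have := binary_word_of_part lam.
  by rewrite /binary -vE (perm_all _ (perm_phi v)).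
have xb : binary x by move: vb; rewrite xE /binary all_cat => /andP[].
have tE : size (unpaired2 v) = (scan x).1.
  rewrite size_unpaired2 // xE /scan foldl_cat -/(scan x).
  by case: (scan x).
have [||mu [muC muE]] := @CSV_iter_gamma _ x 0 lam xb (erefl _).
- by [].
- by rewrite -vE xE -cats1 -catA.
exists mu; split=> //; first exact: CSV_range muC.
rewrite muE /GK tE xE size_cat addnK take_size_cat //.
rewrite -cats1 -catA addn0; case: (x) => //.
Qed.
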